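(* Let $\mathcal{T}=(X,\mathit{init},\mathit{step})$ be an STS and $\varphi=\forall\pi_1:\xi_1\cdots\forall\pi_l:\xi_l.\,\exists\pi_{l+1}:\xi_{l+1}\cdots\exists\pi_k:\xi_k.\,\phi$ an OHyperLTL formula such that for every $l<i\le k$ and every $t\in\mathit{Traces}(\mathcal{T})$, $\mathit{valid}(t,\xi_i)$ holds. Let $\mathcal{A}_\phi=(Q_\phi,q_{\phi,0},\delta_\phi,B_\phi)$ be a deterministic symbolic safety automaton for $\phi$, and $\mathcal{P}=\{p_1,\dots,p_n\}$ a finite set of relational predicates such that every edge formula of $\mathcal{A}_\phi$ and every formula $\mathit{init}_{\langle\pi_i\rangle}$ and $(\xi_i)_{\langle\pi_i\rangle}$ ($1\le i\le k$) is expressible in $\mathcal{P}$. If player $\mathtt{SAFE}$ wins the safety game $\mathcal{G}_{\forall\exists}(\mathcal{T},\varphi,\mathcal{P})$, then $\mathcal{T}\models\varphi$.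
   Context: Fixed background first-order theory. An STS is $\mathcal{T}=(X,\mathit{init},\mathit{step})$, $X$ a finite set of variables, $\mathit{init}$ a formula over $X$, $\mathit{step}$ a formula over $X\uplus X'$ ($X'=\{x'\mid x\in X\}$). Traces of $\mathcal{T}$: infinite sequences $\mu_0\mu_1\cdots$ of assignments to $X$ with $\mu_0\models\mathit{init}$ and $\mu_i\uplus\mu'_{i+1}\models\mathit{step}$ (where $\mu'(x')=\mu(x)$). Trace variables $\pi_1,\dots,\pi_k$; $X_\pi=\{x_\pi\mid x\in X\}$, $\vec X=\bigcup_i X_{\pi_i}$, $X'_\pi=\{x'_\pi\mid x\in X\}$, $\vec X'=\bigcup_i X'_{\pi_i}$. $\theta_{\langle\pi\rangle}$ replaces $x$ by $x_\pi$ (and $x'$ by $x'_\pi$); $\theta^{\langle'\rangle}$ replaces $x_\pi$ by $x'_\pi$. OHyperLTL: the body $\phi$ is built from atoms $\theta$ (formulas over $\vec X$) with $\neg,\wedge,\mathsf{X},\mathsf{U}$; for a trace assignment $\Pi$, $\Pi(i)(x_\pi)=\Pi(\pi)(i)(x)$, $\Pi,i\models\theta$ iff $\Pi(i)\models\theta$, $\Pi,i\models\mathsf X\phi$ iff $\Pi,i+1\models\phi$, $\Pi,i\models\phi_1\mathsf U\phi_2$ iff $\exists j\ge i$: $\Pi,j\models\phi_2$ and $\Pi,m\models\phi_1$ for $i\le m<j$. $\mathit{valid}(t,\xi)$ iff $t(i)\models\xi$ for infinitely many $i$; then $t|_\xi(i)=t(j)$ for $j$ the $i$-th index with $t(j)\models\xi$.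 $\mathcal{T}\models\varphi$ (for $\varphi$ as in the claim) iff for all $t_1,\dots,t_l\in\mathit{Traces}(\mathcal{T})$ with $\mathit{valid}(t_i,\xi_i)$ there exist $t_{l+1},\dots,t_k\in\mathit{Traces}(\mathcal{T})$ with $\mathit{valid}(t_i,\xi_i)$ such that $[\pi_i\mapsto t_i|_{\xi_i}]_{i=1}^k,0\models\phi$. A symbolic safety automaton $\mathcal{A}=(Q,q_0,\delta,B)$: finite $Q$, $B\subseteq Q$, finite edge set $\delta$ of triples $(q,\theta,q')$ with $\theta$ over $\vec X$; a run on a sequence $w$ of assignments to $\vec X$ is $q_0q_1\cdots$ with edges $(q_i,\theta_i,q_{i+1})\in\delta$, $w(i)\models\theta_i$; $w$ accepted iff no run visits $B$. Deterministic: for each $q$ and assignment $\mu$ exactly one edge $(q,\theta,q')$ with $\mu\models\theta$. $\mathcal{A}_\phi$ is for $\phi$ if it accepts $\Pi(0)\Pi(1)\cdots$ iff $\Pi,0\models\phi$. Relational predicates are formulas over $\vec X$; expressible in $\mathcal{P}$ means equivalent to a Boolean combination of members of $\mathcal{P}$. Abstract states $\hat s\in\mathbb{B}^n$, $\mathit{pred}(\hat s)=\bigwedge_{i=1}^n(p_i$ if $\hat s[i]=\top$ else $\neg p_i)$. $\mathit{obs}(\hat s)\in\mathbb{B}^k$, $\mathit{obs}(\hat s)[i]=\top$ iff $\mathit{pred}(\hat s)\wedge(\xi_i)_{\langle\pi_i\rangle}$ satisfiable. $\delta_\phi(q,\hat s)$ is the unique $q'$ with an edge $(q,\theta,q')\in\delta_\phi$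 and $\mathit{pred}(\hat s)\wedge\theta$ satisfiable. For $M\subseteq\{\pi_1,\dots,\pi_k\}$ and $1\le i\le k$ let $S_i^M$ be $\mathit{step}_{\langle\pi_i\rangle}$ if $\pi_i\in M$ and $\bigwedge_{x\in X}x'_{\pi_i}=x_{\pi_i}$ otherwise. For $A\subseteq\mathbb{B}^n$, $\mathit{valid}(\hat s,M,A)$ holds iff the following formula is valid: $\forall\{X_{\pi_i}\}_{i=1}^k.\forall\{X'_{\pi_i}\}_{i=1}^l.\ \big(\mathit{pred}(\hat s)\wedge\bigwedge_{i=1}^lS_i^M\big)\Rightarrow\exists\{X'_{\pi_i}\}_{i=l+1}^k.\ \bigwedge_{i=l+1}^kS_i^M\wedge\bigvee_{\hat s'\in A}\mathit{pred}(\hat s')^{\langle'\rangle}$. Safety game $(S_{\mathtt{SAFE}},S_{\mathtt{REACH}},S_0,T,B)$: plays are infinite paths from $S_0$; positional strategies choose a successor at own states; $\mathtt{SAFE}$ wins if some strategy $\sigma$ ensures no $\sigma$-compatible play from any initial state visits $B$. The game $\mathcal{G}_{\forall\exists}(\mathcal{T},\varphi,\mathcal{P})$: $\mathtt{SAFE}$-states $(\hat s,q,b)$ with $\hat s\in\mathbb{B}^n,q\in Q_\phi,b\in\mathbb{B}^k$; $\mathtt{REACH}$-states $(\hat s,q,b,M,A)$ with $\emptyset\ne M\subseteq\{\pi_1,\dots,\pi_k\}$ and $A\subseteq\mathbb{B}^n$. Initial states: $(\hat s,q_{\phi,0},\top^k)$ with $\mathit{pred}(\hat s)\wedge\bigwedge_{i=1}^k\mathit{init}_{\langle\pi_i\rangle}$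 satisfiable. Bad states: those with $q\in B_\phi$. Transitions: (1) $(\hat s,q,b)\to(\hat s,q,b,M,A)$ if for all $\pi_i\in M$, $\neg b[i]\vee\neg\mathit{obs}(\hat s)[i]$, and $\mathit{valid}(\hat s,M,A)$; (2) $(\hat s,q,\top^k)\to(\hat s,\delta_\phi(q,\hat s),\bot^k)$ if $\mathit{obs}(\hat s)=\top^k$; (3) $(\hat s,q,b,M,A)\to(\hat s',q,b')$ if $\hat s'\in A$ and $b'$ is $b$ with $b'[i]=\top$ for all $\pi_i\in M$. *)

(* Defs.v *)
From Stdlib Require List.
From mathcomp Require Import all_boot.
From mathcomp Require Import boolp classical_sets.

Set Implicit Arguments.
Unset Strict Implicit.
Unset Printing Implicit Defensive.

Record signature := Signature {
  fsym : Type; farity : fsym -> nat;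
  rsym : Type; rarity : rsym -> nat }.

Inductive term (sg : signature) (V : Type) : Type :=
| Var of V
| App (f : fsym sg) of ('I_(farity f) -> term sg V).

(* [formula sg V] is the type of first-order formulas with free variables in
   [V]; a quantifier binds the extra variable [None] of [option V], so renaming
   of free variables cannot capture. *)
Inductive formula (sg : signature) (V : Type) : Type :=
| FTrue
| FEq of term sg V & term sg V
| FRel (r : rsym sg) of ('I_(rarity r) -> term sg V)
| FNeg of formula sg V
| FAnd of formula sg V & formula sg V
| FAll of formula sg (option V).

Arguments Var {sg V} _.
Arguments App {sg V} f _.
Arguments FTrue {sg V}.
Arguments FRel {sg V} r _.

Definition FFalse {sg V} : formula sg V := FNeg FTrue.
Definition FOr sg V (a b : formula sg V) := FNeg (FAnd (FNeg a) (FNeg b)).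

Fixpoint trename sg V W (f : V -> W) (t : term sg V) : term sg W :=
  match t with
  | Var x => Var (f x)
  | App g args => App g (fun i => trename f (args i))
  end.

Fixpoint rename sg V W (f : V -> W) (a : formula sg V) : formula sg W :=
  match a with
  | FTrue => FTrue
  | FEq t u => FEq (trename f t) (trename f u)
  | FRel r args => FRel r (fun i => trename f (args i))
  | FNeg a => FNeg (rename f a)
  | FAnd a b => FAnd (rename f a) (rename f b)
  | FAll a => FAll (rename (omap f) a)
  end.

Record structure (sg : signature) := Structure {
  carrier :> Type;
  carrier_inhabited : inhabited carrier;
  finterp : forall f : fsym sg, ('I_(farity f) -> carrier) -> carrier;
  rinterp : forall r : rsym sg, ('I_(rarity r) -> carrier) -> Prop }.

Fixpoint teval sg (D : structure sg) V (mu : V -> D) (t : term sg V) : D :=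
  match t with
  | Var x => mu x
  | App f args => finterp (fun i => teval mu (args i))
  end.

Fixpoint sat sg (D : structure sg) V (mu : V -> D) (a : formula sg V) : Prop :=
  match a with
  | FTrue => True
  | FEq t u => teval mu t = teval mu u
  | FRel r args => rinterp (fun i => teval mu (args i))
  | FNeg a => ~ sat mu a
  | FAnd a b => sat mu a /\ sat mu b
  | FAll a => forall d : D,
      sat (fun y : option V => if y is Some x then mu x else d) a
  end.

(* A theory is a set of sentences.  Satisfiability, validity and equivalence of
   formulas are modulo the theory, i.e. over all its models, whereas program
   variables take values in one given model; a theory presented by a single
   structure [D] is the set of all sentences true in [D]. *)
Definition theory sg := formula sg void -> Prop.

Definition models sg (D : structure sg) (Th : theory sg) : Prop :=
  forall a, Th a -> sat (of_void D) a.

Definition satisfiable sg (Th : theory sg) V (a : formula sg V) : Prop :=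
  exists2 D : structure sg, models D Th & exists mu : V -> D, sat mu a.

Definition equivalent sg (Th : theory sg) V (a b : formula sg V) : Prop :=
  forall D : structure sg, models D Th ->
  forall mu : V -> D, sat mu a <-> sat mu b.

Inductive bool_comb sg V n (P : 'I_n -> formula sg V) : formula sg V -> Prop :=
| bc_mem i : bool_comb P (P i)
| bc_true : bool_comb P FTrue
| bc_neg a : bool_comb P a -> bool_comb P (FNeg a)
| bc_and a b : bool_comb P a -> bool_comb P b -> bool_comb P (FAnd a b).

Definition expressible sg (Th : theory sg) V n (P : 'I_n -> formula sg V)
    (a : formula sg V) : Prop :=
  exists2 b, bool_comb P b & equivalent Th a b.

(* In a sum of two copies of a set of variables, [inl x] is the variable x and
   [inr x] its primed version x'. *)
Definition join_asg V (D : Type) (mu mu' : V -> D) (y : V + V) : D :=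
  match y with inl x => mu x | inr x => mu' x end.

Record sts sg (X : finType) := Sts {
  init : formula sg X;
  step : formula sg (X + X) }.

Definition trace sg (D : structure sg) (X : finType) := nat -> X -> D.

Definition is_trace sg (D : structure sg) (X : finType) (T : sts sg X)
    (t : trace D X) : Prop :=
  sat (t 0) (init T) /\ forall i, sat (join_asg (t i) (t i.+1)) (step T).

(* Trace variables are the indices [i : 'I_k] (counted from 0), and the pair
   [(i, x)] is the copy of the program variable x for the i-th of them. *)
Definition tvars k (X : finType) : Type := ('I_k * X)%type.

Definition idx1 sg k (X : finType) (i : 'I_k) (a : formula sg X) :
    formula sg (tvars k X) := rename (pair i) a.

Definition idx2 sg k (X : finType) (i : 'I_k) (a : formula sg (X + X)) :
    formula sg (tvars k X + tvars k X) :=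
  rename (fun y => match y with inl x => inl (i, x) | inr x => inr (i, x) end) a.

Inductive body sg (V : Type) : Type :=
| Atom of formula sg V
| BNeg of body sg V
| BAnd of body sg V & body sg V
| BNext of body sg V
| BUntil of body sg V & body sg V.

(* The quantifier prefix is forall for the trace variables [i < l] and exists
   for the trace variables [l <= i < k]. *)
Record ohyperltl sg (X : finType) (k l : nat) := OHyperLTL {
  obs_point : 'I_k -> formula sg X;
  obody : body sg (tvars k X) }.

Definition trace_asg sg (D : structure sg) (X : finType) k :=
  'I_k -> trace D X.

Definition at_time sg (D : structure sg) (X : finType) k
    (Pi : trace_asg D X k) (i : nat) : tvars k X -> D :=
  fun y => Pi y.1 i y.2.

Fixpoint holds sg (D : structure sg) (X : finType) k (Pi : trace_asg D X k)
    (i : nat) (phi : body sg (tvars k X)) : Prop :=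
  match phi with
  | Atom a => sat (at_time Pi i) a
  | BNeg phi => ~ holds Pi i phi
  | BAnd phi psi => holds Pi i phi /\ holds Pi i psi
  | BNext phi => holds Pi i.+1 phi
  | BUntil phi psi => exists j, [/\ i <= j, holds Pi j psi &
      forall m, i <= m < j -> holds Pi m phi]
  end.

Definition obs_valid sg (D : structure sg) (X : finType) (t : trace D X)
    (xi : formula sg X) : Prop :=
  forall m, exists2 i, m <= i & sat (t i) xi.

Definition is_obs_index sg (D : structure sg) (X : finType) (t : trace D X)
    (xi : formula sg X) (i j : nat) : Prop :=
  sat (t j) xi /\ count (fun m => `[< sat (t m) xi >]) (iota 0 j) = i.

(* Meaningful only under [obs_valid t xi]; then the index chosen by [xget] is
   the unique one satisfying [is_obs_index]. *)
Definition obs_trace sg (D : structure sg) (X : finType) (t : trace D X)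
    (xi : formula sg X) : trace D X :=
  fun i => t (xget 0 (is_obs_index t xi i)).

(* [t] carries the universally quantified traces; its components from [l] on
   are unconstrained and ignored. *)
Definition sts_models sg (D : structure sg) (X : finType) k l (T : sts sg X)
    (phi : ohyperltl sg X k l) : Prop :=
  forall t : trace_asg D X k,
  (forall i : 'I_k, i < l ->
     is_trace T (t i) /\ obs_valid (t i) (obs_point phi i)) ->
  exists u : trace_asg D X k,
  [/\ forall i : 'I_k, i < l -> u i = t i,
      forall i : 'I_k, l <= i ->
        is_trace T (u i) /\ obs_valid (u i) (obs_point phi i) &
      holds (fun i => obs_trace (u i) (obs_point phi i)) 0 (obody phi)].

Record automaton sg (V : Type) := Automaton {
  astate : finType;
  ainit : astate;
  aedges : seq (astate * formula sg V * astate);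
  abad : {set astate} }.

Definition is_run sg (D : structure sg) V (A : automaton sg V)
    (w : nat -> V -> D) (r : nat -> astate A) : Prop :=
  r 0 = ainit A /\
  forall i, exists2 a, List.In (r i, a, r i.+1) (aedges A) & sat (w i) a.

Definition accepts sg (D : structure sg) V (A : automaton sg V)
    (w : nat -> V -> D) : Prop :=
  forall r, is_run w r -> forall i, r i \notin abad A.

Definition deterministic sg (D : structure sg) V (A : automaton sg V) : Prop :=
  forall (q : astate A) (mu : V -> D),
  exists! e : formula sg V * astate A,
    List.In (q, e.1, e.2) (aedges A) /\ sat mu e.1.

Definition automaton_for sg (D : structure sg) (X : finType) k
    (A : automaton sg (tvars k X)) (phi : body sg (tvars k X)) : Prop :=
  forall Pi : trace_asg D X k, accepts A (at_time Pi) <-> holds Pi 0 phi.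

Definition abs_state n := {ffun 'I_n -> bool}.

Definition pred_of sg V n (P : 'I_n -> formula sg V) (s : abs_state n) :
    formula sg V :=
  \big[@FAnd sg V/FTrue]_(i < n) (if s i then P i else FNeg (P i)).

Definition obs_of sg (Th : theory sg) (X : finType) k l n
    (phi : ohyperltl sg X k l) (P : 'I_n -> formula sg (tvars k X))
    (s : abs_state n) : {ffun 'I_k -> bool} :=
  [ffun i => `[< satisfiable Th
                   (FAnd (pred_of P s) (idx1 i (obs_point phi i))) >]].

Definition abs_edge sg (Th : theory sg) V n (A : automaton sg V)
    (P : 'I_n -> formula sg V) (q : astate A) (s : abs_state n)
    (q' : astate A) : Prop :=
  exists2 a, List.In (q, a, q') (aedges A) &
    satisfiable Th (FAnd (pred_of P s) a).

(* The graph of the partial function q, s |-> delta(q, s). *)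
Definition abs_delta sg (Th : theory sg) V n (A : automaton sg V)
    (P : 'I_n -> formula sg V) (q : astate A) (s : abs_state n)
    (q' : astate A) : Prop :=
  unique (abs_edge Th P q s) q'.

Definition move sg (X : finType) k (T : sts sg X) (M : {set 'I_k}) (i : 'I_k) :
    formula sg (tvars k X + tvars k X) :=
  if i \in M then idx2 i (step T)
  else \big[@FAnd _ _/FTrue]_(x : X) FEq (Var (inr (i, x))) (Var (inl (i, x))).

(* The quantifier blocks are evaluated semantically: the inner existential block
   re-binds exactly the primed variables of the trace variables [l <= i], hence
   [nu] and [mu'] agree on the others.  The values of [mu'] on the re-bound
   variables are irrelevant. *)
Definition valid_move sg (Th : theory sg) (X : finType) k (l : nat) n
    (T : sts sg X) (P : 'I_n -> formula sg (tvars k X))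
    (s : abs_state n) (M : {set 'I_k}) (A : {set abs_state n}) : Prop :=
  forall D : structure sg, models D Th -> forall mu mu' : tvars k X -> D,
  sat (join_asg mu mu')
    (FAnd (rename inl (pred_of P s))
          (\big[@FAnd _ _/FTrue]_(i < k | i < l) move T M i)) ->
  exists nu : tvars k X -> D,
    (forall (i : 'I_k) (x : X), i < l -> nu (i, x) = mu' (i, x)) /\
    sat (join_asg mu nu)
      (FAnd (\big[@FAnd _ _/FTrue]_(i < k | l <= i) move T M i)
            (\big[@FOr _ _/FFalse]_(s' in A) rename inr (pred_of P s'))).

Record safety_game := SafetyGame {
  safe_state : Type;
  reach_state : Type;
  ginit : safe_state + reach_state -> Prop;
  gtrans : safe_state + reach_state -> safe_state + reach_state -> Prop;
  gbad : safe_state + reach_state -> Prop }.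

Definition gstate (G : safety_game) : Type := (safe_state G + reach_state G)%type.

Definition is_play (G : safety_game) (rho : nat -> gstate G) : Prop :=
  ginit (rho 0) /\ forall i, gtrans (rho i) (rho i.+1).

Definition is_strategy (G : safety_game) (sigma : safe_state G -> gstate G) :
    Prop :=
  forall s, gtrans (inl s) (sigma s).

Definition compatible (G : safety_game) (sigma : safe_state G -> gstate G)
    (rho : nat -> gstate G) : Prop :=
  forall i s, rho i = inl s -> rho i.+1 = sigma s.

Definition safe_wins (G : safety_game) : Prop :=
  exists2 sigma : safe_state G -> gstate G, is_strategy sigma &
  forall rho, is_play rho -> compatible sigma rho -> forall i, ~ gbad (rho i).

Record fe_safe (Q : Type) (k n : nat) := FESafe {
  fs_abs : abs_state n; fs_q : Q; fs_b : {ffun 'I_k -> bool} }.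

Record fe_reach (Q : Type) (k n : nat) := FEReach {
  fr_abs : abs_state n; fr_q : Q; fr_b : {ffun 'I_k -> bool};
  fr_M : {set 'I_k}; fr_M_neq0 : fr_M != finset.set0;
  fr_A : {set abs_state n} }.

Definition fe_init sg (Th : theory sg) (X : finType) k n (T : sts sg X)
    (A : automaton sg (tvars k X)) (P : 'I_n -> formula sg (tvars k X))
    (g : fe_safe (astate A) k n + fe_reach (astate A) k n) : Prop :=
  exists2 s : abs_state n,
    satisfiable Th (FAnd (pred_of P s)
      (\big[@FAnd _ _/FTrue]_(i < k) idx1 i (init T))) &
    g = inl (FESafe s (ainit A) [ffun=> true]).

Inductive fe_trans sg (Th : theory sg) (X : finType) k l n (T : sts sg X)
    (phi : ohyperltl sg X k l) (A : automaton sg (tvars k X))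
    (P : 'I_n -> formula sg (tvars k X)) :
    fe_safe (astate A) k n + fe_reach (astate A) k n ->
    fe_safe (astate A) k n + fe_reach (astate A) k n -> Prop :=
| fe_choose (s : abs_state n) (q : astate A) (b : {ffun 'I_k -> bool})
    (M : {set 'I_k}) (M_neq0 : M != finset.set0) (C : {set abs_state n}) :
    (forall i, i \in M -> ~~ b i || ~~ obs_of Th phi P s i) ->
    valid_move Th l T P s M C ->
    fe_trans Th T phi P (inl (FESafe s q b)) (inr (FEReach s q b M_neq0 C))
| fe_observe (s : abs_state n) (q q' : astate A) :
    obs_of Th phi P s = [ffun=> true] ->
    abs_delta Th P q s q' ->
    fe_trans Th T phi P (inl (FESafe s q [ffun=> true]))
                        (inl (FESafe s q' [ffun=> false]))
| fe_resolve (s : abs_state n) (q : astate A) (b : {ffun 'I_k -> bool})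
    (M : {set 'I_k}) (M_neq0 : M != finset.set0) (C : {set abs_state n}) s' :
    s' \in C ->
    fe_trans Th T phi P (inr (FEReach s q b M_neq0 C))
                        (inl (FESafe s' q [ffun i => (i \in M) || b i])).

Definition fe_bad sg (X : finType) k n (A : automaton sg (tvars k X))
    (g : fe_safe (astate A) k n + fe_reach (astate A) k n) : Prop :=
  match g with
  | inl s => fs_q s \in abad A
  | inr r => fr_q r \in abad A
  end.

Definition fe_game sg (Th : theory sg) (X : finType) k l n (T : sts sg X)
    (phi : ohyperltl sg X k l) (A : automaton sg (tvars k X))
    (P : 'I_n -> formula sg (tvars k X)) : safety_game :=
  @SafetyGame (fe_safe (astate A) k n) (fe_reach (astate A) k n)
    (@fe_init sg Th X k n T A P) (@fe_trans sg Th X k l n T phi A P)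
    (@fe_bad sg X k n A).

(* Main.v *)
Require Import Defs.
From Stdlib Require List.
From mathcomp Require Import all_boot zify.
From mathcomp Require Import boolp classical_sets.

(** Fix a winning strategy of SAFE and the universally quantified traces.  We
    run the game against them: a configuration couples a game position with
    concrete values of all the trace variables, abstracted by the position, and
    each [valid_move] supplies both the next values of the existential copies
    and REACH's answer.  The flag [b i] is down exactly when the current point
    of trace [i] was the last one observed, so the number of observations made
    so far is the number of observation points that trace [i] has gone through.
    Hence if only finitely many observations were made, every trace whose
    observation points recur would be moved finitely often, which is impossible
    as each move advances some trace.  So observations recur, the existential
    traces are infinite, the [m]-th observation is made at the [m]-th
    observation point of every trace, and the automaton state of the play
    follows every run of the automaton on the observed traces. *)

Set Implicit Arguments.
Unset Strict Implicit.
Unset Printing Implicit Defensive.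

(** * Satisfaction under renaming, finite connectives and predicate abstraction *)

Section Semantics.
Variables (sg : signature) (D : structure sg).

Lemma teval_trename V W (f : V -> W) (mu : W -> D) (t : term sg V) :
  teval mu (trename f t) = teval (mu \o f) t.
Proof.
elim: t => //= g args IH; congr finterp.
by apply/funext => i; exact: IH.
Qed.

Lemma sat_rename V W (f : V -> W) (mu : W -> D) (a : formula sg V) :
  sat mu (rename f a) <-> sat (mu \o f) a.
Proof.
elim: a W f mu => {V} [V|V t u|V r args|V a IH|V a IHa b IHb|V a IH] W f mu //=.
- by rewrite !teval_trename.
- rewrite (_ : (fun i => teval mu (trename f (args i))) =
               (fun i => teval (mu \o f) (args i))) //.
  by apply/funext => i; exact: teval_trename.
- by rewrite IH.
- by rewrite IHa IHb.
- split=> H d; have := H d; rewrite IH;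
    by rewrite (_ : _ \o omap f =
      (fun y => if y is Some x then (mu \o f) x else d)) //;
      apply/funext => -[].
Qed.

Lemma sat_bigand V (mu : V -> D) (I : finType) (p : pred I)
    (F : I -> formula sg V) :
  sat mu (\big[@FAnd sg V/FTrue]_(i | p i) F i) <->
  forall i, p i -> sat mu (F i).
Proof.
suff H (r : seq I) : sat mu (\big[@FAnd sg V/FTrue]_(i <- r | p i) F i) <->
    forall i, i \in r -> p i -> sat mu (F i).
  rewrite H; split=> h i; last by move=> _; exact: h.
  by apply: h; rewrite mem_index_enum.
elim: r => [|j r IH]; first by rewrite big_nil.
rewrite big_cons; case: ifP => pj /=; rewrite IH; split.
- by move=> [hj h] i; rewrite inE => /predU1P[->|/h].
- by move=> h; split=> [|i ir]; apply: h; rewrite // inE ?eqxx ?ir ?orbT.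
- by move=> h i; rewrite inE => /predU1P[->|/h//]; rewrite pj.
- by move=> h i ir; apply: h; rewrite inE ir orbT.
Qed.

Lemma sat_bigor V (mu : V -> D) (I : finType) (p : pred I)
    (F : I -> formula sg V) :
  sat mu (\big[@FOr sg V/FFalse]_(i | p i) F i) ->
  exists2 i, p i & sat mu (F i).
Proof.
elim/big_rec: _ => [/(_ Logic.I)//|i a pi IH /= /not_andP[] /contrapT //].
by exists i.
Qed.

Lemma sat_idx1 (X : finType) k (i : 'I_k) (a : formula sg X)
    (mu : tvars k X -> D) :
  sat mu (idx1 i a) <-> sat (fun x => mu (i, x)) a.
Proof. exact: sat_rename. Qed.

Lemma sat_move (X : finType) k (T : sts sg X) (M : {set 'I_k}) (i : 'I_k)
    (mu nu : tvars k X -> D) :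
  sat (join_asg mu nu) (move T M i) <->
  if i \in M
  then sat (join_asg (fun x => mu (i, x)) (fun x => nu (i, x))) (step T)
  else forall x, nu (i, x) = mu (i, x).
Proof.
rewrite /move; case: ifP => _.
  rewrite sat_rename /comp (_ : (fun y => _) =
    join_asg (fun x => mu (i, x)) (fun x => nu (i, x))) //.
  by apply/funext => -[].
by rewrite sat_bigand; split=> h x; have := h x; [apply|].
Qed.

Lemma sat_pred_of V n (P : 'I_n -> formula sg V) (s : abs_state n)
    (mu : V -> D) :
  sat mu (pred_of P s) <-> forall i, sat mu (P i) <-> s i.
Proof.
rewrite sat_bigand; split=> h i.
  by have := h i isT; case: (s i) => //= hi; split.
by move=> _; case: (s i) (h i) => /= -[h1 h2]; [apply: h2|move/h1].
Qed.

Lemma sat_pred_of_abs V n (P : 'I_n -> formula sg V) (mu : V -> D) :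
  sat mu (pred_of P [ffun i => `[< sat mu (P i) >]]).
Proof. by apply/sat_pred_of => i; rewrite ffunE; split=> /asboolP. Qed.

End Semantics.

(** The abstract state fixes the truth value of every predicate, whatever the structure. Two
    structures are needed because a satisfiability witness may live in another model of the
    theory. *)
Lemma bool_comb_pred_of sg V n (P : 'I_n -> formula sg V) (s : abs_state n)
    (a : formula sg V) (D1 D2 : structure sg) (mu1 : V -> D1) (mu2 : V -> D2) :
  bool_comb P a -> sat mu1 (pred_of P s) -> sat mu2 (pred_of P s) ->
  sat mu1 a <-> sat mu2 a.
Proof.
move=> Pa /sat_pred_of h1 /sat_pred_of h2.
elim: Pa => [i||b _ IH|b c _ IHb _ IHc] //=.
- by rewrite h1 h2.
- by rewrite IH.
- by rewrite IHb IHc.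
Qed.

(** Turns the satisfiability tests of the game into facts about the concrete values of the play: any
    witness shares the abstract state of [mu], so it agrees with [mu] on [a]. *)
Lemma expressible_satisfiable sg (Th : theory sg) V n
    (P : 'I_n -> formula sg V) (s : abs_state n) (a : formula sg V)
    (D : structure sg) (mu : V -> D) :
  models D Th -> expressible Th P a -> sat mu (pred_of P s) ->
  satisfiable Th (FAnd (pred_of P s) a) <-> sat mu a.
Proof.
move=> DTh [b Pb ab] mus; split=> [[D' D'Th [mu' [mu's mu'a]]]|mua].
  apply/(ab _ DTh)/(bool_comb_pred_of Pb mu's mus).
  exact/(ab _ D'Th).
by exists D => //; exists mu.
Qed.

(** A discrete intermediate value argument: the wanted index is the predecessor of the least one at
    which [f] exceeds [m]. *)
Lemma unit_steps_hit (f : nat -> nat) :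
  f 0 = 0 -> (forall n, f n.+1 <= (f n).+1) -> (forall m, exists n, m <= f n) ->
  forall m, exists n, f n = m /\ f n.+1 = m.+1.
Proof.
move=> f0 f1 f_unb m; have ex : exists n, m < f n by exact: f_unb.
case: (ex_minnP ex) => -[|n]; first by rewrite f0.
move=> mfn min_n; exists n.
have fnm : f n <= m by rewrite leqNgt; apply/negP => /min_n; rewrite ltnn.
have := f1 n; have fn1 := leq_trans mfn (f1 n).
have -> : f n = m by apply/eqP; rewrite eqn_leq fnm -ltnS.
by move=> h; split=> //; apply/eqP; rewrite eqn_leq h.
Qed.

(** * Counting the observation points of a single trace *)

Section ObservationCount.
Variables (sg : signature) (D : structure sg) (X : finType).
Variables (t : trace D X) (xi : formula sg X).

(** The same count as in [is_obs_index], so that the two unfold to each other; the point [j] itself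
    is excluded. *)
Definition obs_count (j : nat) : nat :=
  count (fun m => `[< sat (t m) xi >]) (iota 0 j).

Lemma obs_countS j : obs_count j.+1 = obs_count j + `[< sat (t j) xi >].
Proof. by rewrite /obs_count -addn1 iotaD count_cat /= addn0. Qed.

Lemma obs_count_leq j : obs_count j <= j.
Proof. by rewrite -{2}(size_iota 0 j); exact: count_size. Qed.

Lemma obs_count_mono : {homo obs_count : i j / i <= j}.
Proof. by apply: homo_leq leq_trans _ => // i; rewrite obs_countS leq_addr. Qed.

Lemma obs_count_unbounded : obs_valid t xi -> forall m, exists j, m <= obs_count j.
Proof.
move=> tv; elim=> [|m [j hj]]; first by exists 0.
have [i ji ti] := tv j; exists i.+1.
by rewrite obs_countS asboolT // addn1 ltnS (leq_trans hj) // obs_count_mono.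
Qed.

(** The count rises right after an observation point, so a later one has a larger count. *)
Lemma is_obs_index_inj i j1 j2 :
  is_obs_index t xi i j1 -> is_obs_index t xi i j2 -> j1 = j2.
Proof.
wlog: j1 j2 / j1 <= j2 => [H h1 h2|].
  by case/orP: (leq_total j1 j2) => h; [|symmetry]; exact: H.
rewrite leq_eqVlt => /predU1P[//|j12] [s1 c1] [_ c2].
have := obs_count_mono j12; rewrite obs_countS asboolT // addn1.
by rewrite /obs_count c1 c2 ltnn.
Qed.

Lemma obs_trace_index i j : is_obs_index t xi i j -> obs_trace t xi i = t j.
Proof.
by move=> h; rewrite /obs_trace; case: xgetP => [m _ hm|/(_ j)//];
  rewrite (is_obs_index_inj hm h).
Qed.

End ObservationCount.

(** * Concrete runs of the game under a strategy of SAFE *)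

Section ConcretePlay.
Variables (sg : signature) (Th : theory sg) (D : structure sg) (X : finType).
Variables (k l n : nat) (T : sts sg X) (phi : ohyperltl sg X k l).
Variables (A : automaton sg (tvars k X)) (P : 'I_n -> formula sg (tvars k X)).
Hypothesis D_models : models D Th.

Notation state := (fe_safe (astate A) k n + fe_reach (astate A) k n)%type.

Definition abs_of (g : state) : abs_state n :=
  match g with inl s => fs_abs s | inr r => fr_abs r end.
Definition aut_of (g : state) : astate A :=
  match g with inl s => fs_q s | inr r => fr_q r end.
Definition flag_of (g : state) : {ffun 'I_k -> bool} :=
  match g with inl s => fs_b s | inr r => fr_b r end.

(** [cpos] counts the steps taken by each trace, [cobs] the observation transitions made in the
    play. *)
Record config := Config {
  cstate : state;
  cval : tvars k X -> D;
  cpos : 'I_k -> nat;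
  cobs : nat }.

Variables (sigma : fe_safe (astate A) k n -> state) (t : trace_asg D X k).
Hypothesis sigma_trans : forall s, fe_trans Th T phi P (inl s) (sigma s).
Hypothesis t_trace : forall i : 'I_k, i < l -> is_trace T (t i).

Variant safe_trans_spec (s : fe_safe (astate A) k n) : state -> Prop :=
| SafeChoose (M : {set 'I_k}) (M_neq0 : M != finset.set0) (C : {set abs_state n})
    of (forall i, i \in M -> ~~ fs_b s i || ~~ obs_of Th phi P (fs_abs s) i)
    & valid_move Th l T P (fs_abs s) M C :
    safe_trans_spec s (inr (FEReach (fs_abs s) (fs_q s) (fs_b s) M_neq0 C))
| SafeObserve q' of fs_b s = [ffun=> true]
    & obs_of Th phi P (fs_abs s) = [ffun=> true]
    & abs_delta Th P (fs_q s) (fs_abs s) q' :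
    safe_trans_spec s (inl (FESafe (fs_abs s) q' [ffun=> false])).

Lemma safe_transP s : safe_trans_spec s (sigma s).
Proof.
move: (sigma_trans s); move E: (inl s) => g tr.
case: tr E => // [s' q b M M0 C hM vM|s' q q' obsT qq'] [->].
  exact: SafeChoose.
exact: SafeObserve.
Qed.

(** The conditions on SAFE's choice are carried along at REACH positions, whose type does not record
    them. *)
Definition consistent (c : config) : Prop :=
  [/\ sat (cval c) (pred_of P (abs_of (cstate c))),
      forall i : 'I_k, i < l -> forall x, cval c (i, x) = t i (cpos c i) x &
      if cstate c is inr r then
        valid_move Th l T P (fr_abs r) (fr_M r) (fr_A r) /\
        forall i, i \in fr_M r -> ~~ fr_b r i || ~~ obs_of Th phi P (fr_abs r) i
      else True].

Definition config_step (c c' : config) : Prop :=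
  match cstate c with
  | inl s =>
      [/\ cstate c' = sigma s, cval c' = cval c, cpos c' = cpos c &
          cobs c' = cobs c + (if sigma s is inl _ then 1 else 0)]
  | inr r =>
      [/\ exists2 s', s' \in fr_A r &
            cstate c' =
              inl (FESafe s' (fr_q r) [ffun i => (i \in fr_M r) || fr_b r i]),
          forall i, cpos c' i = cpos c i + (i \in fr_M r),
          cobs c' = cobs c &
          forall i, if i \in fr_M r
            then sat (join_asg (fun x => cval c (i, x))
                               (fun x => cval c' (i, x))) (step T)
            else forall x, cval c' (i, x) = cval c (i, x)]
  end.

(** At a REACH position, [valid_move] is applied with the universal copies following [t]. It yields
    values for the existential copies, and the disjunct they satisfy serves as REACH's answer. *)
Lemma config_step_total c :
  consistent c -> exists c', consistent c' /\ config_step c c'.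
Proof.
case: c => -[s|r] mu pos N [/= mus mut hr].
  exists (Config (sigma s) mu pos (N + (if sigma s is inl _ then 1 else 0))).
  split=> //; split=> //=.
    by case: (safe_transP s).
  by case: (safe_transP s).
have [vM _] := hr.
(* Only the copies below [l] matter here; [valid_move] rebinds all others. *)
pose mu' y := if y.1 \in fr_M r then t y.1 (pos y.1).+1 y.2 else mu y.
have mu'_move (i : 'I_k) : i < l -> if i \in fr_M r
    then sat (join_asg (fun x => mu (i, x)) (fun x => mu' (i, x))) (step T)
    else forall x, mu' (i, x) = mu (i, x).
  move=> il; rewrite /mu' /=; case: (i \in fr_M r) => //.
  rewrite (_ : (fun x => mu (i, x)) = t i (pos i)); first exact: (t_trace il).2.
  by apply/funext => x; rewrite mut.
have [|nu [nu_mu' []]] := vM D D_models mu mu'.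
  split; first by rewrite sat_rename.
  by apply/sat_bigand => i il; apply/sat_move/mu'_move.
move=> /sat_bigand nu_ex /sat_bigor[s' s'A /sat_rename nu_s'].
exists (Config (inl (FESafe s' (fr_q r) [ffun i => (i \in fr_M r) || fr_b r i]))
  nu (fun i => pos i + (i \in fr_M r)) N).
split; split=> //=.
- move=> i il x; rewrite nu_mu' // /mu' /=; case: ifP => _.
    by rewrite addn1.
  by rewrite addn0 mut.
- by exists s'.
- move=> i; case: (ltnP i l) => il; last exact/sat_move/nu_ex.
  have <- : (fun x => mu' (i, x)) = (fun x => nu (i, x)).
    by apply/funext => x; rewrite nu_mu'.
  have := mu'_move i il; case: ifP => // _ mu'E x.
  by rewrite nu_mu'.
Qed.

Lemma concrete_play_exists c0 : consistent c0 ->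
  exists rho : nat -> config, [/\ rho 0 = c0, forall m, consistent (rho m) &
    forall m, config_step (rho m) (rho m.+1)].
Proof.
move=> c0_ok.
have /choice[next nextP] c :
    exists c', consistent c -> consistent c' /\ config_step c c'.
  (* An inconsistent configuration gets itself as a dummy successor. *)
  case: (pselect (consistent c)) => [/config_step_total[c' h]|h]; last by exists c.
  by exists c'.
have ok m : consistent (iter m next c0).
  by elim: m => //= m /nextP[].
by exists (fun m => iter m next c0); split=> // m; have [] := nextP _ (ok m).
Qed.

(** * The traces read off a run from an initial position *)

Variable rho : nat -> config.
Hypothesis rho_ok : forall m, consistent (rho m).
Hypothesis rho_step : forall m, config_step (rho m) (rho m.+1).
Hypothesis rho_abs0 :
  cstate (rho 0) = inl (FESafe (abs_of (cstate (rho 0))) (ainit A) [ffun=> true]).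
Hypothesis rho_pos0 : forall i, cpos (rho 0) i = 0.
Hypothesis rho_obs0 : cobs (rho 0) = 0.
Hypothesis rho_init : forall i, sat (fun x => cval (rho 0) (i, x)) (init T).
Hypothesis point_expr :
  forall i, expressible Th P (idx1 i (obs_point phi i)).

Lemma cstate_trans m :
  fe_trans Th T phi P (cstate (rho m)) (cstate (rho m.+1)).
Proof.
have [_ _] := rho_ok m; have := rho_step m; rewrite /config_step.
case: (cstate (rho m)) => [s|[s q b M M0 C]] /=; first by case=> ->.
by move=> [[s' s'C ->] _ _ _] _; exact: fe_resolve.
Qed.

Lemma cstate_compatible :
  @compatible (fe_game Th T phi A P) sigma (fun m => cstate (rho m)).
Proof. by move=> m s /= E; have := rho_step m; rewrite /config_step E => -[]. Qed.

Lemma cpos_stepS m i : cpos (rho m.+1) i <= (cpos (rho m) i).+1.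
Proof.
have := rho_step m; rewrite /config_step.
case: (cstate (rho m)) => [s [_ _ -> _]//|r [_ -> _ _]].
by rewrite -addn1 leq_add2l leq_b1.
Qed.

Lemma cobs_stepS m : cobs (rho m.+1) <= (cobs (rho m)).+1.
Proof.
have := rho_step m; rewrite /config_step.
case: (cstate (rho m)) => [s [_ _ _ ->]|r [_ _ -> _]//].
by case: (sigma s) => _; rewrite ?addn1 ?addn0.
Qed.

Lemma cpos_stationary m i :
  cpos (rho m.+1) i = cpos (rho m) i ->
  forall x, cval (rho m.+1) (i, x) = cval (rho m) (i, x).
Proof.
have := rho_step m; rewrite /config_step.
case: (cstate (rho m)) => [s [_ -> //]|r [_ -> _ /(_ i)]].
case: ifP => // _ _ /eqP.
by rewrite addn1 gtn_eqF.
Qed.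

Lemma cpos_moved m i :
  cpos (rho m.+1) i = (cpos (rho m) i).+1 ->
  sat (join_asg (fun x => cval (rho m) (i, x))
                (fun x => cval (rho m.+1) (i, x))) (step T).
Proof.
have := rho_step m; rewrite /config_step.
case: (cstate (rho m)) => [s [_ _ -> _]|r [_ -> _ /(_ i)]].
  by move/eqP; rewrite ltn_eqF.
by case: ifP => // _ _ /eqP; rewrite addn0 ltn_eqF.
Qed.

Lemma cpos_homo i : {homo (fun m => cpos (rho m) i) : m m' / m <= m'}.
Proof.
apply: homo_leq leq_trans _ => // m.
have := rho_step m; rewrite /config_step.
case: (cstate (rho m)) => [s [_ _ -> _]//|r [_ -> _ _]].
exact: leq_addr.
Qed.

(* Meaningful at the positions that trace [i] reaches in [rho]. *)
Definition built_trace : trace_asg D X k := fun i j x =>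
  cval (rho (xget 0 [set m | cpos (rho m) i = j]%classic)) (i, x).

(** The moment picked by [xget] is irrelevant: a copy keeps its values while its position stays the
    same, and positions never decrease. *)
Lemma built_traceE m i :
  (fun x => cval (rho m) (i, x)) = built_trace i (cpos (rho m) i).
Proof.
have H m1 d : cpos (rho (m1 + d)) i = cpos (rho m1) i ->
    forall x, cval (rho (m1 + d)) (i, x) = cval (rho m1) (i, x).
  elim: d => [|d IH]; first by rewrite addn0.
  rewrite addnS => E.
  have E' : cpos (rho (m1 + d)) i = cpos (rho m1) i.
    apply/eqP; rewrite eqn_leq (@cpos_homo i m1) ?leq_addr // andbT -E.
    exact: cpos_homo.
  by move=> x; rewrite cpos_stationary ?E ?E' // IH.
apply/funext => x; rewrite /built_trace; case: xgetP => [m' _ /= E|/(_ m)[] //].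
case/orP: (leq_total m m') => le.
  by have := H m (m' - m); rewrite subnKC // => ->.
by have := H m' (m - m'); rewrite subnKC // => ->.
Qed.

(** Positions grow by at most one, so an unbounded one passes from [j] to [j.+1] at some moment, and
    that move satisfies [step T]. *)
Lemma built_trace_is_trace i :
  (forall j, exists m, j <= cpos (rho m) i) -> is_trace T (built_trace i).
Proof.
move=> unb; split; first by rewrite -(rho_pos0 i) -built_traceE.
move=> j.
have [m [Em Em1]] := unit_steps_hit (rho_pos0 i) (fun m => cpos_stepS m i) unb j.
rewrite -{1}Em -Em1 -!built_traceE.
by apply: cpos_moved; rewrite Em.
Qed.

Lemma obs_ofE m i :
  obs_of Th phi P (abs_of (cstate (rho m))) i =
  `[< sat (built_trace i (cpos (rho m) i)) (obs_point phi i) >].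
Proof.
have [mus _ _] := rho_ok m.
rewrite ffunE; apply: asbool_equiv_eq.
by rewrite -built_traceE (expressible_satisfiable D_models _ mus) // sat_idx1.
Qed.

(* A lowered flag means that the current point of trace [i] is an observation
   point and has already been observed. *)
Lemma cobs_count m i :
  (~~ flag_of (cstate (rho m)) i ->
     sat (built_trace i (cpos (rho m) i)) (obs_point phi i)) /\
  obs_count (built_trace i) (obs_point phi i) (cpos (rho m) i)
    + ~~ flag_of (cstate (rho m)) i = cobs (rho m).
Proof.
elim: m => [|m [IHf IHc]].
  by rewrite rho_abs0 rho_pos0 rho_obs0 /= ffunE.
have := obs_ofE m i; have [_ _] := rho_ok m; have := rho_step m.
rewrite /config_step; move: IHf IHc.
case: (cstate (rho m)) => [s|r] /=.
  move=> IHf IHc [-> _ -> ->] _; move: IHf IHc.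
  case: (safe_transP s) => [M M0 C _ _|q' -> obsT _] /=.
    by rewrite addn0.
  rewrite obsT !ffunE /= addn0 => _ -> /esym/asboolP h.
  by split.
move=> IHf IHc [[s' _ ->] -> -> _] [_ hM] oE; rewrite /= ffunE.
case: (boolP (i \in fr_M r)) => [iM|_] /=; last by rewrite addn0.
split=> //; rewrite addn0 addn1 obs_countS -IHc; congr (_ + _).
(* SAFE may not move a trace off an observation point whose flag is up, so the count rises exactly
   when the flag was down. *)
have := hM i iM; rewrite oE; case: (fr_b r i) IHf => /= IHf; last first.
  by move=> _; rewrite asboolT //; exact: IHf.
by case: (`[< _ >]).
Qed.

(** * Observations recur *)

Hypothesis built_valid : forall i : 'I_k,
  (forall j, exists m, j <= cpos (rho m) i) ->
  obs_valid (built_trace i) (obs_point phi i).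

(* Every game step increases this quantity. *)
Lemma progress m :
  m <= 2 * (\sum_i cpos (rho m) i) + 2 * cobs (rho m)
       + (if cstate (rho m) is inr _ then 1 else 0).
Proof.
elim: m => // m IH; apply: leq_ltn_trans IH _.
have := rho_step m; rewrite /config_step.
case: (cstate (rho m)) => [s|r] /=.
  by move=> [-> _ -> ->]; case: (sigma s) => _; lia.
move=> [[s' _ ->] posE -> _]; rewrite (eq_bigr _ (fun i _ => posE i)) big_split /=.
(* Some trace advances, and the factor 2 outweighs the 1 lost on leaving a REACH position. *)
have [i iM] := set0Pn _ (fr_M_neq0 r).
rewrite [\sum_j (_ \in _ : nat)](bigD1 i) //= iM; lia.
Qed.

Lemma cobs_unbounded K : exists m, K <= cobs (rho m).
Proof.
apply: contrapT => /forallNP bnd.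
have {}bnd m : cobs (rho m) <= K by have /negP := bnd m; rewrite -ltnNge => /ltnW.
have /choice[c cP] i : exists c, forall m, cpos (rho m) i <= c.
  (* An unbounded position would pass more than [K] observation points, all of them counted by
     [cobs]. *)
  apply: contrapT => /forallNP unb.
  have {}unb j : exists m, j <= cpos (rho m) i.
    have /existsNP[m /negP h] := unb j; exists m.
    by rewrite ltnW // ltnNge.
  have [j Kj] := obs_count_unbounded (built_valid unb) K.+1.
  have [m jm] := unb j.
  have := leq_trans Kj (obs_count_mono _ _ jm).
  move=> /leq_trans/(_ (leq_addr (~~ flag_of (cstate (rho m)) i) _)).
  by rewrite (cobs_count m i).2 ltnNge bnd.
(* With all positions and [cobs] bounded, [N] bounds the quantity of [progress] at every moment, in
   particular at [N.+1]. *)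
pose N := 2 * (\sum_i c i) + 2 * K + 1.
have := leq_trans (progress N.+1) _; move/(_ N); rewrite ltnn => H.
suff: false by []. apply: H.
apply: leq_add; last by case: (cstate _).
by apply: leq_add; rewrite leq_mul2l /= ?bnd //; apply: leq_sum.
Qed.

(** A position is at least its observation count, which lags behind [cobs] by at most one; hence the
    [j.+1]. *)
Lemma cpos_unbounded i j : exists m, j <= cpos (rho m) i.
Proof.
have [m jm] := cobs_unbounded j.+1; exists m.
rewrite -ltnS; apply: leq_trans jm _.
rewrite -(cobs_count m i).2 -addn1.
by apply: leq_add; [exact: obs_count_leq|exact: leq_b1].
Qed.

(** * Automaton runs on the observed traces *)

Definition observed : trace_asg D X k :=
  fun i => obs_trace (built_trace i) (obs_point phi i).

(** When an observation is made all flags are up, so by [cobs_count] each trace has exactly [cobs]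
    observation points behind it and stands on the next one. *)
Lemma at_time_observed m :
  cobs (rho m.+1) = (cobs (rho m)).+1 -> at_time observed (cobs (rho m)) = cval (rho m).
Proof.
move=> E; apply/funext => -[i x]; rewrite /at_time /observed /=.
rewrite (@obs_trace_index _ _ _ _ _ _ (cpos (rho m) i)).
  by rewrite -built_traceE.
have := obs_ofE m i; have := cobs_count m i; move: E.
have := rho_step m; rewrite /config_step.
case: (cstate (rho m)) => [s|r] /=; last first.
  by move=> [_ _ -> _] /eqP; rewrite ltn_eqF.
move=> [_ _ _ ->].
case: (safe_transP s) => [M M0 C _ _|q' -> obsT _] /=.
  by rewrite addn0 => /eqP; rewrite ltn_eqF.
rewrite obsT !ffunE /= addn0 => _ [_ cE] /esym/asboolP h.
by split.
Qed.

(** The edge taken by [r] is satisfied by the current values, hence compatible with the abstract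
    state; uniqueness in [abs_delta] forces the same target. *)
Lemma aut_of_run r : is_run (A := A) (at_time observed) r ->
  forall m, aut_of (cstate (rho m)) = r (cobs (rho m)).
Proof.
move=> [r0 rS]; elim=> [|m IH]; first by rewrite rho_abs0 rho_obs0 r0.
have := @at_time_observed m; have := rho_step m; have [+ _ _] := rho_ok m.
rewrite /config_step; move: IH.
case: (cstate (rho m)) => [s|q] /=; last by move=> qE _ [[s' _ ->] _ -> _].
move=> + + [-> _ _ ->]; case: (safe_transP s) => [M M0 C _ _|q' _ _ [_ q'uniq]] /=.
  by rewrite addn0.
move=> qE mus; rewrite addn1 => /(_ erefl) wE.
have [a inA wa] := rS (cobs (rho m)).
apply: q'uniq; exists a; first by rewrite qE.
by exists D => //; exists (cval (rho m)); split=> //; rewrite -wE.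
Qed.

(** Every index of a run is a value of [cobs] at some moment, where the run is in the state of the
    play. *)
Lemma observed_accepted :
  (forall m, aut_of (cstate (rho m)) \notin abad A) ->
  accepts A (at_time observed).
Proof.
move=> safe r run j.
have [m [<- _]] := unit_steps_hit rho_obs0 cobs_stepS cobs_unbounded j.
by rewrite -(aut_of_run run).
Qed.

End ConcretePlay.

(** * Soundness of the game *)

Theorem theorem3 (sg : signature) (Th : theory sg) (D : structure sg)
    (X : finType) (k l n : nat) (T : sts sg X) (phi : ohyperltl sg X k l)
    (A : automaton sg (tvars k X)) (P : 'I_n -> formula sg (tvars k X))
    (D_models : models D Th)
    (l_gt0 : 0 < l) (l_le_k : l <= k)
    (ex_valid : forall i : 'I_k, l <= i -> forall t : trace D X,
       is_trace T t -> obs_valid t (obs_point phi i))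
    (A_det : deterministic D A)
    (A_phi : automaton_for D A (obody phi))
    (edges_expr : forall q a q', List.In (q, a, q') (aedges A) ->
       expressible Th P a)
    (init_expr : forall i : 'I_k, expressible Th P (idx1 i (init T)))
    (point_expr : forall i : 'I_k,
       expressible Th P (idx1 i (obs_point phi i)))
    (safe_win : safe_wins (fe_game Th T phi A P)) :
  sts_models D T phi.
Proof.
have [sigma sigma_trans sigma_win] := safe_win.
move=> t tP.
pose i0 := Ordinal (leq_trans l_gt0 l_le_k).
have t_trace (i : 'I_k) (il : i < l) : is_trace T (t i) := (tP i il).1.
(* The existential copies may start wherever a universal trace does. *)
pose mu0 (y : tvars k X) := t (if y.1 < l then y.1 else i0) 0 y.2.
have mu0_init i : sat (fun x => mu0 (i, x)) (init T).
  by rewrite /mu0 /=; case: ifP => il; apply: (t_trace _ _).1.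
pose s0 : abs_state n := [ffun i => `[< sat mu0 (P i) >]].
have mu0_s0 : sat mu0 (pred_of P s0) by exact: sat_pred_of_abs.
pose c0 : config D n A :=
  Config (inl (FESafe s0 (ainit A) [ffun=> true])) mu0 (fun=> 0) 0.
have c0_ok : consistent Th T phi P t c0.
  by split=> //= i il x; rewrite /mu0 /= il.
have [rho [rho0 rho_ok rho_step]] :=
  concrete_play_exists D_models sigma_trans t_trace c0_ok.
have rho_abs0 : cstate (rho 0) =
    inl (FESafe (abs_of (cstate (rho 0))) (ainit A) [ffun=> true]).
  by rewrite rho0.
have rho_pos0 i : cpos (rho 0) i = 0 by rewrite rho0.
have rho_obs0 : cobs (rho 0) = 0 by rewrite rho0.
have rho_init i : sat (fun x => cval (rho 0) (i, x)) (init T) by rewrite rho0.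
(* Consistency ties a universal copy to [t] at the positions it reaches; unboundedness makes these
   all positions. *)
have built_t (i : 'I_k) : i < l -> (forall j, exists m, j <= cpos (rho m) i) ->
    built_trace rho i = t i.
  move=> il unb; apply/funext => j.
  have [m [<- _]] :=
    unit_steps_hit (rho_pos0 i) (fun m => cpos_stepS rho_step m i) unb j.
  rewrite -(built_traceE rho_step); apply/funext => x.
  by have [_ -> //] := rho_ok m.
have built_trace_T := built_trace_is_trace rho_step rho_pos0 rho_init.
have built_valid (i : 'I_k) : (forall j, exists m, j <= cpos (rho m) i) ->
    obs_valid (built_trace rho i) (obs_point phi i).
  (* Universal traces recur by assumption on [t]; existential ones because every trace of [T]
     does. *)
  move=> unb; case: (ltnP i l) => il; last exact/ex_valid/built_trace_T.
  by rewrite built_t //; exact: (tP i il).2.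
have pos_unb : forall i j, exists m, j <= cpos (rho m) i.
  exact: (cpos_unbounded D_models sigma_trans rho_ok).
exists (built_trace rho); split=> [i il|i il|].
- exact: built_t.
- by split; [exact: built_trace_T|exact: built_valid].
apply/A_phi; apply: (observed_accepted D_models sigma_trans rho_ok) => // m.
have := @sigma_win (fun m => cstate (rho m)) _
  (cstate_compatible rho_step) m.
rewrite /= /fe_bad /aut_of => bad; apply/negP => h; apply: bad.
  split; last exact: (cstate_trans sigma_trans rho_ok).
  rewrite rho0; exists s0 => //; exists D => //; exists mu0; split=> //.
  by apply/sat_bigand => i _; apply/sat_idx1.
by case: (cstate (rho m)) h.
Qed.
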